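(* Suppose the market maker holds belief $\widetilde W(\cdot\mid\cdot)\colon X\times S\to\mathbb R$ about insider demand (so that, conditional on signal $s_k$, he believes order flow is $\omega_i=\widetilde W(x_i\mid s_k)+\varepsilon_i$, $i=1,2,\dots$) and receives aggregate order flow $\omega=(\omega_i)$. (i) His posterior distribution over signals conditional on $\omega$ is $$\pi_1(s_k\mid\omega;\widetilde W)=\frac{1}{C(\omega)}\exp\Big(\sum_i\frac{\widetilde W(x_i\mid s_k)\,\omega_i}{\sigma_i^2}-\frac12\sum_i\frac{\widetilde W(x_i\mid s_k)^2}{\sigma_i^2}\Big)\pi_0(s_k),\qquad k=1,\dots,K,$$ where $C(\omega)$ is the normalizing factor making these weights sum to one over $S$. (ii) The posterior $\pi_1(\cdot\mid\omega;\widetilde W)$ depends on $\omega$ only through the vector of noise-adjusted scores $$\Big(\sum_i\frac{\widetilde W(x_i\mid s_k)\,\omega_i}{\sigma_i^2}\Big)_{s_k\in S}\in\mathbb R^K,$$ so these scores form a sufficient statistic for his inference about the signal.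
   Context: Setting. $X=\{x_1,x_2,\dots\}$ is a countable (finite or infinite) set of states; $S=\{s_1,\dots,s_K\}$ is a finite set of signals with prior probabilities $\pi_0(s_k)$. For each market $i$ let $\sigma_i>0$; noise trades $\varepsilon_i\sim\mathcal N(0,\sigma_i^2)$ are independent across $i$ and independent of the signal. Order flow $\omega=(\omega_i)$ lies in $\Omega=\mathbb R^{\infty}$ (one coordinate per state) with the $\sigma$-field generated by coordinates; $\mathbb P_0$ is the law of $(\varepsilon_i)$, and for a portfolio $W\colon X\to\mathbb R$, $\mathbb P_W$ is the law of $(W(x_i)+\varepsilon_i)$. Portfolios $W$, and each belief $\widetilde W(\cdot\mid s_k)$, satisfy the standing condition $\sum_i W(x_i)^2/\sigma_i^2<\infty$; under it, series such as $\sum_i W(x_i)\omega_i/\sigma_i^2$ are understood as almost surely convergent sums. Under the market maker's belief, the joint law of (order flow, signal) is: the signal has law $\pi_0$, and conditional on $s_k$ order flow has law $\mathbb P_{\widetilde W(\cdot\mid s_k)}$. *)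

(* Defs.v *)
From HB Require Import structures.
From mathcomp Require Import all_boot all_order all_algebra finmap.
From mathcomp Require Import all_classical all_reals all_analysis.

Set Implicit Arguments.
Unset Strict Implicit.
Unset Printing Implicit Defensive.

Import Order.TTheory GRing.Theory Num.Theory.
Import numFieldNormedType.Exports.

Local Open Scope classical_set_scope.
Local Open Scope ring_scope.

Section CoordinateSpace.
Variables (I : Type) (R : realType).

Definition cylinders : set (set (I -> R)) :=
  [set A | exists (i : I) (B : set R),
     measurable B /\ A = (fun f : I -> R => f i) @^-1` B].

(* [R^I] with the sigma-algebra generated by the coordinates: the space of
   order flows for [I] the set of states, and the space of score vectors for
   [I] the set of signals. *)
Definition coord_space := g_sigma_algebraType cylinders.

HB.instance Definition _ := Measurable.on coord_space.

End CoordinateSpace.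

Section Series.
Variables (R : realType) (X : Type).

(* [x] lists the elements of [X] without repetition.  It is partial so as to
   cover both finite and infinite [X]; indices sent to [None] contribute
   nothing to the sums over states below. *)
Definition listing (x : nat -> option X) : Prop :=
  forall y : X, exists! n : nat, x n = Some y.

Definition state_partial_sums (x : nat -> option X) (F : X -> R) : R^nat :=
  series (fun n => oapp F 0 (x n)).

(* [lim] takes an arbitrary fixed value when the partial sums diverge. *)
Definition state_sum (x : nat -> option X) (F : X -> R) : R :=
  limn (state_partial_sums x F).

Definition square_summable (x : nat -> option X) (sigma W : X -> R) : Prop :=
  (\sum_(0 <= n <oo) (oapp (fun y => W y ^+ 2 / sigma y ^+ 2) 0 (x n))%:E
     < +oo)%E.

End Series.

Section Laws.
Variables (R : realType) (X : choiceType).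
Local Notation Omega := (coord_space X R).

(* Second argument of [normal_prob]: the standard deviation. *)
Definition noise_law (sigma : X -> R) (P0 : probability Omega R) : Prop :=
  (forall (y : X) (B : set R), measurable B ->
     P0 [set w : Omega | B (w y)] = normal_prob 0 (sigma y) B) /\
  (forall (J : {fset X}) (B : X -> set R),
     (forall y, measurable (B y)) ->
     P0 [set w : Omega | forall y, y \in J -> B y (w y)] =
     (\prod_(y <- J) P0 [set w : Omega | B y (w y)])%E).

Definition portfolio_law (P0 : probability Omega R) (W : X -> R)
    : set Omega -> \bar R :=
  pushforward P0 (fun e : Omega => (fun y => W y + e y) : Omega).

(* [omega] and [s] realize, on the probability space [(T, P)], the joint law of
   order flow and signal under the belief [W]. *)
Definition market_maker_belief (S : finType) (pi0 : S -> R)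
    (P0 : probability Omega R) (W : X -> S -> R)
    d (T : measurableType d) (P : probability T R)
    (omega : {RV P >-> Omega}) (s : T -> S) : Prop :=
  (forall k : S, measurable (s @^-1` [set k])) /\
  (forall (k : S) (A : set Omega), measurable A ->
     P (omega @^-1` A `&` s @^-1` [set k]) =
     ((pi0 k)%:E * portfolio_law P0 (W^~ k) A)%E).

End Laws.

Section Posterior.
Variables (R : realType) (d : measure_display) (T : measurableType d).
Variables (P : probability T R) (S : finType) (s : T -> S).

(* [pi] is a version of the conditional distribution of [s] given [Y]. *)
Definition is_posterior d' (E : measurableType d') (Y : T -> E)
    (pi : S -> E -> R) : Prop :=
  [/\ forall k, measurable_fun setT (pi k),
      forall k e, 0 <= pi k e,
      forall e, \sum_(k : S) pi k e = 1 &
      forall (k : S) (A : set E), measurable A ->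
        (\int[P]_(t in Y @^-1` A) (pi k (Y t))%:E =
         P (Y @^-1` A `&` s @^-1` [set k]))%E].

(* Bayesian sufficiency: observing the statistic [h] of [Y] yields the same
   posterior as observing [Y] itself. *)
Definition sufficient_statistic d1 (E : measurableType d1)
    d2 (F : measurableType d2) (Y : T -> E) (h : E -> F) : Prop :=
  measurable_fun setT h /\
  exists2 g : S -> F -> R,
    is_posterior (h \o Y) g &
    forall pi : S -> E -> R, is_posterior Y pi ->
      {ae P, forall t, forall k, pi k (Y t) = g k (h (Y t))}.

End Posterior.

Definition depends_only_through (R : realType) (S : Type)
    d1 (E : measurableType d1) d2 (F : measurableType d2)
    (pi : S -> E -> R) (h : E -> F) : Prop :=
  exists2 g : S -> F -> R,
    forall k, measurable_fun setT (g k) & forall k e, pi k e = g k (h e).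

Section Formula.
Variables (R : realType) (X : choiceType) (x : nat -> option X) (S : finType).
Variables (pi0 : S -> R) (sigma : X -> R) (W : X -> S -> R).
Local Notation Omega := (coord_space X R).

Definition score_term (w : Omega) (k : S) (y : X) : R :=
  W y k * w y / sigma y ^+ 2.

Definition scores (w : Omega) : coord_space S R :=
  fun k => state_sum x (score_term w k).

Definition posterior_weight (k : S) (w : Omega) : R :=
  expR (scores w k - 2^-1 * state_sum x (fun y => W y k ^+ 2 / sigma y ^+ 2))
  * pi0 k.

Definition normalizer (w : Omega) : R := \sum_(k : S) posterior_weight k w.

Definition posterior_formula (k : S) (w : Omega) : R :=
  (normalizer w)^-1 * posterior_weight k w.

End Formula.

(* Main.v *)
Require Import Defs.
From HB Require Import structures.
From mathcomp Require Import all_boot all_order all_algebra finmap ring lra.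
From mathcomp Require Import all_classical all_reals all_analysis.
From mathcomp Require Import measurable_realfun.

(* Translating the law of the noise by finitely many coordinates of a portfolio
   [V] multiplies it by the density [L_n = exp (S_n - c_n / 2)], where [S_n] and
   [c_n] are the partial sums of [V w / sigma^2] and [V^2 / sigma^2]. Optional
   stopping for [L_n] gives an exponential maximal inequality, which, applied to
   multiples of tails of [V] and [-V], makes [S_n] almost surely Cauchy. The
   [L_n] are bounded in L^2, hence uniformly integrable, so their limit is the
   density of the full translation (Cameron-Martin). The posterior formula is
   then Bayes' rule for the densities [L] of the conditional laws of order flow
   with respect to the noise law. *)

Set Implicit Arguments.
Unset Strict Implicit.
Unset Printing Implicit Defensive.

Import Order.TTheory GRing.Theory Num.Theory.
Import numFieldNormedType.Exports.

Local Open Scope classical_set_scope.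
Local Open Scope ring_scope.

(** All estimates rest on one identity, [integral_likelihood]: the integral of a likelihood over an
    event is the [P0]-probability of a translated event. In particular it is at most 1 for every
    portfolio, and the freedom to rescale the portfolio does the rest: [t V] gives exponential tails
    with [t] to choose, and [2 V] gives the L^2 bound. The obstacle is that the scores converge only
    almost surely, while [lim] is total, so the formula also has values on a null set where they
    carry no meaning. Hence the statements about posteriors are almost sure, whereas the
    factorization through the scores is an identity between functions. The null set is found under
    the noise law; it stays null for order flow because the law of order flow has density
    [normalizer] with respect to [P0]. *)

Lemma finite_measure_eq d (T : measurableType d) (R : realType)
    (G : set (set T)) (m1 m2 : {measure set T -> \bar R}) :
  measurable = <<s G >> -> setI_closed G -> G setT -> (m1 setT < +oo)%E ->
  (forall A, G A -> m1 A = m2 A) ->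
  forall A, measurable A -> m1 A = m2 A.
Proof.
move=> mG IG GT m1oo m12 A mA.
apply: (measure_unique G (fun=> setT)) => //.
by apply/seteqP; split => // t _; exists 0%N.
Qed.

(* [pushforward m f] is a measure only when [f] is measurable; packing the proof
   lets the structure be inferred. *)
Definition pushforward_measure d d' (T1 : measurableType d)
  (T2 : measurableType d') (R : realType) (m : {measure set T1 -> \bar R})
  (f : T1 -> T2) (mf : measurable_fun setT f) : {measure set T2 -> \bar R}.
Proof. by refine (pushforward m f); exact: mf. Defined.

(** * Measures with a density *)

Section Density.
Import HBNNSimple.
Local Open Scope ereal_scope.
Context d (T : measurableType d) (R : realType).
Variables (mu : {measure set T -> \bar R}) (f : T -> R).
Hypotheses (mf : measurable_fun setT f) (f_ge0 : forall t, (0 <= f t)%R).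

Definition density (A : set T) : \bar R := \int[mu]_(t in A) (f t)%:E.

Let density0 : density set0 = 0. Proof. exact: integral_set0. Qed.

Let density_ge0 A : 0 <= density A.
Proof. by apply: integral_ge0 => t _; rewrite lee_fin. Qed.

Let density_sigma_additive : semi_sigma_additive density.
Proof.
move=> F mF tF mUF.
have mfF : measurable_fun (\bigcup_k F k) (EFin \o f).
  by apply: measurable_funTS; exact/measurable_EFinP.
rewrite /density ge0_integral_bigcup//; last by move=> t _; rewrite lee_fin.
by apply: is_cvg_nneseries => n _ _; exact: density_ge0.
Qed.

HB.instance Definition _ := isMeasure.Build _ _ _
  density density0 density_ge0 density_sigma_additive.

(** Monotone convergence reduces [g] to simple functions and linearity to indicators, where the
    claim is the hypothesis on [nu]. Leaving [nu] arbitrary lets the lemma serve normal laws,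
    restrictions of [P0], translated noise and the law of order flow. *)
Lemma ge0_integral_density (nu : {measure set T -> \bar R}) (g : T -> \bar R)
    (D : set T) :
  (forall A, measurable A -> nu A = \int[mu]_(t in A) (f t)%:E) ->
  measurable D -> measurable_fun setT g -> (forall t, 0 <= g t) ->
  \int[nu]_(t in D) g t = \int[mu]_(t in D) (g t * (f t)%:E).
Proof.
move=> nuE mD mg g0.
pose h := nnsfun_approx measurableT mg.
have gE t : g t = limn (fun n => (h n t)%:E).
  by apply/esym/cvg_lim => //; exact: (cvg_nnsfun_approx measurableT mg).
have mh n : measurable_fun D (EFin \o h n).
  by apply: measurable_funTS; apply/measurable_EFinP/measurable_funP.
have nd_h t : nondecreasing_seq (fun n => (h n t)%:E).
  move=> a b ab; rewrite lee_fin.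
  by apply/lefP/(nd_nnsfun_approx measurableT mg).
have mfD : measurable_fun D (EFin \o f).
  by apply: measurable_funTS; exact/measurable_EFinP.
transitivity (limn (fun n => \int[nu]_(t in D) (h n t)%:E)).
  under eq_integral do rewrite gE.
  by apply: monotone_convergence => // n t _; rewrite lee_fin.
have hf_nd t : nondecreasing_seq (fun n => (h n t)%:E * (f t)%:E).
  by move=> a b ab; apply: lee_wpmul2r; [rewrite lee_fin|exact: nd_h].
transitivity (limn (fun n => \int[mu]_(t in D) ((h n t)%:E * (f t)%:E))); last first.
  rewrite -monotone_convergence//.
  - apply: eq_integral => t _; apply/cvg_lim => //.
    rewrite gE; apply: cvgeZr => //.
    by rewrite -gE; apply: (cvg_nnsfun_approx measurableT mg).
  - by move=> n; exact: (emeasurable_funM (mh n) mfD).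
  - by move=> n t _; rewrite mule_ge0 ?lee_fin.
congr (limn _); apply/funext => n.
have mind r : measurable_fun D (fun t => (r * \1_(h n @^-1` [set r]) t)%:E).
  apply: measurable_funTS; apply/measurable_EFinP.
  by apply: measurable_funM => //; exact: measurable_indic.
transitivity (\int[nu]_(t in D)
   (\sum_(y \in range (h n)) (y * \1_(h n @^-1` [set y]) t)%:E)).
  by apply: eq_integral => t tE; rewrite /= fimfunE -fsumEFin.
rewrite ge0_integral_fsum//; last by move=> m y Ey; exact: nnfun_muleindic_ge0.
transitivity (\int[mu]_(x in D) (\sum_(y \in range (h n))
    (y * \1_(h n @^-1` [set y]) x)%:E * (f x)%:E)); last first.
  apply: eq_integral => t _.
  rewrite -ge0_mule_fsuml => [|y]; last exact: nnfun_muleindic_ge0.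
  by rewrite fsumEFin // -(fimfunE _ t).
rewrite ge0_integral_fsum//; last 2 first.
  - by move=> y; exact: (emeasurable_funM (mind y) mfD).
  - by move=> m y Ey; apply: mule_ge0; [exact: nnfun_muleindic_ge0|rewrite lee_fin].
apply: eq_fsbigr => r rhn.
have r0 : (0 <= r)%R by move: rhn; rewrite inE => -[t _ <-].
under eq_integral do rewrite EFinM.
under [RHS]eq_integral do rewrite EFinM -muleA.
rewrite !ge0_integralZl_EFin//.
- rewrite integral_indic// nuE//; last exact: measurableI.
  congr (_ * _).
  rewrite setIC integral_mkcondr; apply: eq_integral => t _.
  by rewrite patchE indicE; case: (_ \in _); rewrite ?mul1e ?mul0e.
- by move=> t _; apply: mule_ge0; rewrite lee_fin.
- apply: emeasurable_funM => //; apply: measurable_funTS; apply/measurable_EFinP.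
  exact: measurable_indic.
- by apply: measurable_funTS; apply/measurable_EFinP; exact: measurable_indic.
Qed.

End Density.

Definition density_measure d (T : measurableType d) (R : realType)
  (mu : {measure set T -> \bar R}) (f : T -> R) (mf : measurable_fun setT f)
  (f_ge0 : forall t, 0 <= f t) : {measure set T -> \bar R}.
Proof. by refine (density mu f); [exact: mf|exact: f_ge0]. Defined.

(** * Translation of a one-dimensional normal law *)

Section NormalShift.
Variable R : realType.

Lemma lebesgue_measure_shift (b : R) (A : set R) : measurable A ->
  pushforward (@lebesgue_measure R) (fun u => u + b : measurableTypeR R) A =
  lebesgue_measure A.
Proof.
move=> mA.
have mb : measurable_fun setT (fun u : measurableTypeR R => u + b : measurableTypeR R).
  exact: measurable_funD.
apply/esym.
apply: (lebesgue_measure_unique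
  (mu := pushforward_measure lebesgue_measure mb)) => //= _ [[u v]] _ <-.
rewrite /= /pushforward.
have -> : (fun u => u + b) @^-1` `]u, v] = `]u - b, v - b]%classic.
  by apply/seteqP; split => z /=; rewrite !in_itv/= ltrBlDr lerBrDr.
by rewrite !lebesgue_measure_itv/= !lte_fin ltrD2r -!EFinB opprB addrA subrK.
Qed.

(* [expR (b u / s^2 - b^2 / (2 s^2))] is the density of N(b, s^2) with respect
   to N(0, s^2). *)
Lemma normal_prob_shift (b s : R) (B : set R) : 0 < s -> measurable B ->
  (\int[normal_prob 0 s]_(u in B)
     (expR (b * u / s ^+ 2 - 2^-1 * (b ^+ 2 / s ^+ 2)))%:E =
   normal_prob 0 s [set u | B (u + b)%R])%E.
Proof.
move=> s0 mB.
have sn0 : s != 0 by rewrite gt_eqF.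
have mf : measurable_fun setT
    (fun u : R => expR (b * u / s ^+ 2 - 2^-1 * (b ^+ 2 / s ^+ 2))).
  apply: measurableT_comp => //; apply: measurable_funB => //.
  by apply: measurable_funM => //; apply: measurable_funM.
have mb : measurable_fun setT (fun u : measurableTypeR R => u + b : measurableTypeR R).
  exact: measurable_funD.
have mp : measurable_fun setT (normal_pdf b s) by exact: measurable_normal_pdf.
have mfE : measurable_fun setT
    (fun u : R => (expR (b * u / s ^+ 2 - 2^-1 * (b ^+ 2 / s ^+ 2)))%:E).
  exact/measurable_EFinP.
rewrite (@ge0_integral_density _ _ _ lebesgue_measure _
  (measurable_normal_pdf 0 s) (normal_pdf_ge0 0 s) (normal_prob 0 s)
  _ B (fun _ _ => erefl) mB mfE (fun=> expR_ge0 _)).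
(* Completing the square: the exponential times the density of N(0, s^2) is the density of N(b,
   s^2). *)
transitivity (\int[lebesgue_measure]_(u in B) (normal_pdf b s u)%:E)%E.
  apply: eq_integral => u _.
  rewrite -EFinM !normal_pdfE//; congr EFin.
  rewrite mulrCA -expRD; congr (_ * expR _).
  by field.
(* Change of variable [u + b], allowed by translation invariance; it brings the density back to that
   of N(0, s^2). *)
transitivity (\int[pushforward_measure (@lebesgue_measure R) mb]_(u in B)
    (normal_pdf b s u)%:E)%E.
  by apply: eq_measure_integral => A mA _; exact/esym/lebesgue_measure_shift.
rewrite [LHS](ge0_integral_pushforward mb)//.
- rewrite /normal_prob; apply: eq_integral => u _ /=.
  by rewrite !normal_pdfE// /normal_fun addrK subr0.
- by apply: measurable_funTS; exact/measurable_EFinP.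
- by move=> u _; rewrite lee_fin normal_pdf_ge0.
Qed.

End NormalShift.

(** * Finite-dimensional events *)

Section CoordinateSpaceTheory.
Variables (R : realType) (X : choiceType).
Local Notation Omega := (coord_space X R).

Lemma measurable_coord (y : X) : measurable_fun setT (fun w : Omega => w y).
Proof.
move=> _ B mB; rewrite setTI.
by apply: sub_sigma_algebra; exists y, B.
Qed.

Lemma measurable_fun_coord_space d (T : measurableType d) (f : T -> Omega) :
  (forall y, measurable_fun setT (fun t => f t y)) -> measurable_fun setT f.
Proof.
move=> mf; apply: (@measurability _ _ T Omega setT f (@cylinders X R) erefl).
move=> _ [_ [y [B [mB ->]]] <-]; rewrite setTI.
by have := mf y measurableT _ mB; rewrite setTI.
Qed.

(** Rectangles form a pi-system generating the sigma-algebra, and [noise_law] prescribes [P0] on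
    them; two finite measures are therefore compared here. *)
Definition rectangle (J : {fset X}) (B : X -> set R) : set Omega :=
  [set w | forall y, y \in J -> B y (w y)].

Definition rectangles : set (set Omega) :=
  [set A | exists (J : {fset X}) (B : X -> set R),
     (forall y, measurable (B y)) /\ A = rectangle J B].

Lemma measurable_rectangle J B :
  (forall y, measurable (B y)) -> measurable (rectangle J B).
Proof.
move=> mB.
have -> : rectangle J B = \bigcap_(y in [set` J]) ((fun w : Omega => w y) @^-1` B y).
  by apply/seteqP; split => w h y /=; exact: h.
apply: fin_bigcap_measurable => // y _; rewrite -[X in measurable X]setTI; exact: measurable_coord.
Qed.

Lemma measurable_rectangles : measurable = <<s rectangles >>.
Proof.
apply/seteqP; split.
- apply: smallest_sub; first exact: smallest_sigma_algebra.
  move=> _ [y [B [mB ->]]]; apply: sub_sigma_algebra.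
  exists [fset y]%fset, (fun=> B); split => //.
  apply/seteqP; split => w /=; first by move=> Bw z /[!inE] /eqP ->.
  by apply; rewrite inE.
- apply: smallest_sub; first exact: smallest_sigma_algebra.
  by move=> _ [J [B [mB ->]]]; exact: measurable_rectangle.
Qed.

Lemma setI_closed_rectangles : setI_closed rectangles.
Proof.
move=> _ _ [J [B [mB ->]]] [K [C [mC ->]]].
exists (J `|` K)%fset, (fun y => (if y \in J then B y else setT) `&`
   (if y \in K then C y else setT)); split.
  by move=> y; apply: measurableI; case: ifP.
apply/seteqP; split => w /=.
  move=> [h1 h2] y _; split; case: ifPn => // yJ; [exact: h1|exact: h2].
by move=> h; split => y yJ; have := h y; rewrite inE yJ ?orbT => -[].
Qed.

Lemma rectanglesT : rectangles setT.
Proof.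
by exists fset0, (fun=> setT); split => //; apply/seteqP; split.
Qed.

End CoordinateSpaceTheory.

(** * Translation of the noise *)

Section GaussianShift.
Variables (R : realType) (X : choiceType) (sigma : X -> R).
Local Notation Omega := (coord_space X R).
Variable P0 : probability Omega R.
Hypotheses (sigma_gt0 : forall y, 0 < sigma y) (P0_noise : noise_law sigma P0).

(** Independence of coordinate [j] from those in [K]. Overwriting [B] at [j] by [C] is harmless on
    [K] and turns the event into a rectangle, to which the product formula applies. *)
Lemma noise_rectangleU1 (j : X) (K : {fset X}) (B : X -> set R) (C : set R) :
  j \notin K -> (forall y, measurable (B y)) -> measurable C ->
  P0 (rectangle K B `&` [set w | C (w j)]) =
  (P0 (rectangle K B) * normal_prob 0 (sigma j) C)%E.
Proof.
move=> jK mB mC; have [P0n P0i] := P0_noise.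
pose B' y := if y == j then C else B y.
have B'K y : y \in K -> B' y = B y.
  by rewrite /B' => yK; case: eqVneq yK jK => // -> ->.
have -> : rectangle K B `&` [set w | C (w j)] = rectangle (j |` K)%fset B'.
  apply/seteqP; split => w.
    move=> [h1 h2] y; rewrite !inE => /orP[/eqP ->|yK].
      by rewrite /B' eqxx.
    by rewrite B'K//; exact: h1.
  move=> h; split => [y yK|].
    by rewrite -B'K//; apply: h; rewrite !inE yK orbT.
  by have := h j; rewrite /B' eqxx; apply; rewrite !inE eqxx.
have mB' y : measurable (B' y) by rewrite /B'; case: ifP.
have B'j : B' j = C by rewrite /B' eqxx.
rewrite !P0i// big_fsetU1//= B'j P0n// muleC; congr (_ * _)%E.
rewrite big_seq [RHS]big_seq.
by apply: eq_bigr => y yK; rewrite B'K.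
Qed.

Definition translate (j : X) (b : R) (w : Omega) : Omega :=
  fun y => w y + (if y == j then b else 0).

Lemma measurable_translate j b : measurable_fun setT (translate j b).
Proof.
apply: measurable_fun_coord_space => y.
by apply: measurable_funD => //; exact: measurable_coord.
Qed.

Definition tilt (j : X) (b : R) (w : Omega) : R :=
  expR (b * w j / sigma j ^+ 2 - 2^-1 * (b ^+ 2 / sigma j ^+ 2)).

Lemma measurable_tilt j b : measurable_fun setT (tilt j b).
Proof.
apply: measurableT_comp => //; apply: measurable_funB => //.
apply: measurable_funM => //; apply: measurable_funM => //.
exact: measurable_coord.
Qed.

Lemma tilt_ge0 j b w : 0 <= tilt j b w. Proof. exact: expR_ge0. Qed.

(** The integrand reads coordinate [j] only. By independence, the image under that coordinate of
    [P0] restricted to the rectangle is a multiple of the normal law, so the claim becomes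
    [normal_prob_shift]. *)
Lemma integral_tilt_rectangle j b (K : {fset X}) (B : X -> set R) (C : set R) :
  j \notin K -> (forall y, measurable (B y)) -> measurable C ->
  (\int[P0]_(w in rectangle K B `&` [set w | C (w j)]) (tilt j b w)%:E =
   P0 (rectangle K B `&` [set w | C (w j + b)%R]))%E.
Proof.
move=> jK mB mC.
have mD := measurable_rectangle K mB.
have mCb : measurable [set u | C (u + b)].
  have mb : measurable_fun setT (fun u : R => u + b) by exact: measurable_funD.
  by have := mb measurableT _ mC; rewrite setTI.
have mCj : measurable ((fun w : Omega => w j) @^-1` C).
  by rewrite -[X in measurable X]setTI; exact: measurable_coord.
rewrite (noise_rectangleU1 (C := [set u | C (u + b)]))// -normal_prob_shift//.
pose g (u : R) := (expR (b * u / sigma j ^+ 2 - 2^-1 * (b ^+ 2 / sigma j ^+ 2)))%:E.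
have mg : measurable_fun setT g.
  apply/measurable_EFinP.
  apply: measurableT_comp => //; apply: measurable_funB => //.
  by apply: measurable_funM => //; apply: measurable_funM.
have g0 u : (0 <= g u)%E by rewrite lee_fin expR_ge0.
pose D := rectangle K B.
have ind0 (w : Omega) : 0 <= \1_D w :> R by [].
transitivity (\int[mrestr P0 mD]_(w in (fun w : Omega => w j) @^-1` C) g (w j))%E.
  rewrite [RHS](@ge0_integral_density _ _ _ P0 _ (measurable_indic mD) ind0)//.
  - rewrite setIC integral_mkcondr; apply: eq_integral => w _.
    by rewrite patchE indicE; case: (_ \in _); rewrite ?mule1 ?mule0.
  - by move=> A mA; rewrite integral_indic//= setIC.
  - apply: (measurableT_comp mg); exact: measurable_coord.
have mco : measurable_fun setT (fun w : Omega => w j : measurableTypeR R).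
  exact: measurable_coord.
transitivity (\int[pushforward_measure (mrestr P0 mD) mco]_(u in C) g u)%E.
  apply/esym; rewrite [LHS](ge0_integral_pushforward mco)//.
  exact: measurable_funTS.
have cge0 : 0 <= fine (P0 D) by exact: fine_ge0.
transitivity (\int[mscale (NngNum cge0) (normal_prob 0 (sigma j))]_(u in C) g u)%E.
  apply: eq_measure_integral => A mA _.
  rewrite /= /pushforward /mscale/= /mrestr setIC noise_rectangleU1//.
  by rewrite fineK ?fin_num_measure.
rewrite ge0_integral_mscale//=; last exact: measurable_funTS.
by rewrite fineK ?fin_num_measure.
Qed.

(** Both sides are finite measures in [A]. A rectangle splits into its condition on coordinate [j],
    possibly vacuous, and a rectangle on which translating [j] has no effect. *)
Lemma integral_tilt j b (A : set Omega) : measurable A ->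
  (\int[P0]_(w in A) (tilt j b w)%:E = P0 (translate j b @^-1` A))%E.
Proof.
move=> mA.
pose m1 := density_measure P0 (measurable_tilt j b) (tilt_ge0 j b).
pose m2 := pushforward_measure P0 (measurable_translate j b).
have rect J B : (forall y, measurable (B y)) -> m1 (rectangle J B) = m2 (rectangle J B).
  move=> mB.
  pose K := (J `\ j)%fset.
  have jK : j \notin K by rewrite !inE eqxx.
  pose C := if j \in J then B j else setT.
  have mC : measurable C by rewrite /C; case: ifP.
  have JE : rectangle J B = rectangle K B `&` [set w | C (w j)].
    apply/seteqP; split => w.
      move=> h; split => [y|/=]; first by rewrite !inE => /andP[_]; exact: h.
      by rewrite /C; case: ifP => // jJ; exact: h.
    move=> [h1 h2] y yJ; have [yj|yj] := eqVneq y j.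
      by move: h2; rewrite /= /C -yj yJ.
    by apply: h1; rewrite !inE yj.
  rewrite /m1 /m2 /= /density /pushforward JE integral_tilt_rectangle//.
  congr (P0 _); apply/seteqP; split => w [h1 h2]; split.
  - move=> y yK; rewrite /translate; case: eqVneq yK => [->|_ yK]; first by rewrite (negbTE jK).
    by rewrite addr0; exact: h1.
  - by rewrite /= /translate eqxx.
  - move=> y yK; have := h1 y yK; rewrite /translate; case: eqVneq yK => [->|_ yK].
      by rewrite (negbTE jK).
    by rewrite addr0.
  - by move: h2; rewrite /= /translate eqxx.
apply: (@finite_measure_eq _ _ _ (@rectangles R X) m1 m2) => //.
- exact: measurable_rectangles.
- exact: setI_closed_rectangles.
- exact: rectanglesT.
- have [J [B [mB ->]]] := rectanglesT R X; rewrite rect//.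
  rewrite /m2/=; apply: (le_lt_trans (probability_le1 P0 _)); last by rewrite ltry.
  rewrite -[X in measurable X]setTI; apply: measurable_translate => //.
  exact: measurable_rectangle.
- by move=> _ [J [B [mB ->]]]; exact: rect.
Qed.

End GaussianShift.

(** * Sets of convergence *)

Section ConvergenceSet.
Context d (T : measurableType d) (R : realType).

Lemma measurable_superlevel (f : T -> R) (a : R) :
  measurable_fun setT f -> measurable [set t | a <= f t].
Proof.
move=> mf; have := mf measurableT _ (measurable_itv `[a, +oo[).
by rewrite setTI preimage_itvcy.
Qed.

(** Cauchy's criterion with countably many tolerances and comparison with the single index [m]:
    divergence becomes a countable combination of events, each within reach of a maximal
    inequality. *)
Lemma cvgn_oscillationP (u : R^nat) :
  cvgn u <-> forall j, exists m, forall k, `|u (m + k)%N - u m| < j.+1%:R^-1.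
Proof.
split=> [/cvg_ex[l ul] j|cu].
  have j0 : 0 < (j.+1%:R^-1 / 2 : R) by rewrite divr_gt0 ?invr_gt0.
  have /cvgrPdist_lt/(_ _ j0)[m _ um] := ul.
  exists m => k; rewrite [_ - _](_ : _ = (l - u m) - (l - u (m + k)%N)); last by ring.
  rewrite (le_lt_trans (ler_normB _ _))// [X in _ < X]splitr.
  by rewrite ltrD// um//= leq_addr.
apply/cauchy_cvgP/cauchy_exP => e e0.
have [j je] : exists j, j.+1%:R^-1 < e.
  by have [j] := ltr_add_invr e0; rewrite add0r; exists j.
have [m hm] := cu j; exists (u m), m => // n mn.
rewrite /ball /= distrC; apply: lt_trans je.
by rewrite -(subnKC mn) hm.
Qed.

Variable u : nat -> T -> R.
Hypothesis mu : forall n, measurable_fun setT (u n).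

Definition oscillation_set (e : R) (m : nat) : set T :=
  \bigcup_k [set t | e <= `|u (m + k)%N t - u m t|].

Lemma measurable_oscillation_set e m : measurable (oscillation_set e m).
Proof.
apply: bigcup_measurable => k _; apply: measurable_superlevel.
by apply: measurableT_comp => //; exact: measurable_funB.
Qed.

Lemma not_cvgn_oscillation : [set t | ~ cvgn (u ^~ t)] =
  \bigcup_j \bigcap_m oscillation_set j.+1%:R^-1 m.
Proof.
apply/seteqP; split => t /=.
  move=> nc; apply: contrapT => h; apply: nc; apply/cvgn_oscillationP => j.
  apply: contrapT => nm; apply: h; exists j => // m _.
  apply: contrapT => nk; apply: nm; exists m => k.
  by rewrite ltNge; apply/negP => ek; apply: nk; exists k.
move=> [j _ h] /cvgn_oscillationP/(_ j)[m hm].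
by have [k _] := h m Logic.I; rewrite /= leNgt hm.
Qed.

Lemma measurable_cvgn : measurable [set t | cvgn (u ^~ t)].
Proof.
rewrite -[X in measurable X]setCK; apply: measurableC.
rewrite [X in measurable X]not_cvgn_oscillation.
apply: bigcup_measurable => j _; apply: bigcap_measurable => // m _.
exact: measurable_oscillation_set.
Qed.

Lemma measurable_limn : measurable_fun setT (fun t => limn (u ^~ t)).
Proof.
have mC := measurable_cvgn; set C := [set t | _] in mC.
have mI : measurable_fun setT (\1_C : T -> R) by exact: measurable_indic.
have cuC t : cvgn (fun n => u n t * \1_C t).
  rewrite indicE; have [tC|tC] := boolP (t \in C).
    by under eq_fun do rewrite mulr1; rewrite inE in tC.
  by under eq_fun do rewrite mulr0; exact: is_cvg_cst.
(* Off [C] the value of [limn] is the default [point]. Multiplying by the indicator gives a sequence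
   that converges everywhere, and the second summand restores the default. *)
have -> : (fun t => limn (u ^~ t)) =
    (fun t => limn (fun n => u n t * \1_C t) + (point : R) * (1 - \1_C t)).
  apply/funext => t; rewrite indicE; have [tC|tC] := boolP (t \in C).
    rewrite subrr mulr0 addr0.
    by under [in RHS]eq_fun do rewrite mulr1.
  under [in RHS]eq_fun do rewrite mulr0.
  rewrite lim_cst// add0r subr0 mulr1; apply: dvgP => ct.
  by move/negP: tC; apply; rewrite inE.
apply: measurable_funD; last by apply: measurable_funM => //; exact: measurable_funB.
apply: (@measurable_fun_cvg _ _ _ _ (fun n t => u n t * \1_C t)).
  by move=> n; exact: measurable_funM.
by move=> t _; exact: cuC.
Qed.

End ConvergenceSet.

(** * Likelihood ratios *)

Section Score.
Variables (R : realType) (X : choiceType) (x : nat -> option X) (sigma : X -> R).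
Hypotheses (x_listing : listing x) (sigma_gt0 : forall y, 0 < sigma y).
Local Notation Omega := (coord_space X R).
Implicit Types (V : X -> R) (w : Omega) (n : nat).

Definition state_index (y : X) : nat := sval (cid (x_listing y)).

Lemma state_indexK y : x (state_index y) = Some y.
Proof. by rewrite /state_index; case: cid => n []. Qed.

Lemma state_index_unique y n : x n = Some y -> state_index y = n.
Proof. by rewrite /state_index; case: cid => m [] /= _; exact. Qed.

Definition partial_score V n w : R :=
  state_partial_sums x (fun y => V y * w y / sigma y ^+ 2) n.

Definition partial_energy V n : R :=
  state_partial_sums x (fun y => V y ^+ 2 / sigma y ^+ 2) n.

Definition log_likelihood V n w : R :=
  partial_score V n w - 2^-1 * partial_energy V n.

Definition likelihood V n w : R := expR (log_likelihood V n w).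

Definition finite_shift V n w : Omega :=
  fun y => w y + (if (state_index y < n)%N then V y else 0).

(** The summands are ordered as in [portfolio_law], which is thus the image of [P0] under this map
    by mere unfolding. *)
Definition full_shift V w : Omega := fun y => V y + w y.

Lemma state_partial_sums0 (F : X -> R) : state_partial_sums x F 0%N = 0.
Proof. by rewrite /state_partial_sums /series/= big_geq. Qed.

Lemma state_partial_sumsS (F : X -> R) n : state_partial_sums x F n.+1 =
  state_partial_sums x F n + oapp F 0 (x n).
Proof. by rewrite /state_partial_sums /series/= big_nat_recr. Qed.

Lemma eq_state_partial_sums (F G : X -> R) n :
  (forall y, (state_index y < n)%N -> F y = G y) ->
  state_partial_sums x F n = state_partial_sums x G n.
Proof.
elim: n => [_|n IHn FG]; first by rewrite !state_partial_sums0.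
rewrite !state_partial_sumsS IHn; last by move=> y yn; rewrite FG// ltnW.
congr (_ + _); case xn : (x n) => [y|]//=.
by rewrite FG// (state_index_unique xn).
Qed.

Lemma state_partial_sumsZ (F : X -> R) a n :
  state_partial_sums x (fun y => a * F y) n = a * state_partial_sums x F n.
Proof.
elim: n => [|n IHn]; first by rewrite !state_partial_sums0 mulr0.
by rewrite !state_partial_sumsS IHn mulrDr; case: (x n) => //=; rewrite mulr0.
Qed.

Lemma measurable_partial_score V n : measurable_fun setT (partial_score V n).
Proof.
elim: n => [|n IHn].
  rewrite [X in measurable_fun _ X](_ : _ = cst 0)//.
  by apply/funext => w; exact: state_partial_sums0.
rewrite [X in measurable_fun _ X](_ : _ = (fun w => partial_score V n w +
    oapp (fun y => V y * w y / sigma y ^+ 2) 0 (x n))); last first.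
  by apply/funext => w; exact: state_partial_sumsS.
apply: measurable_funD => //; case: (x n) => //= y.
by apply: measurable_funM => //; apply: measurable_funM => //; exact: measurable_coord.
Qed.

Lemma measurable_log_likelihood V n : measurable_fun setT (log_likelihood V n).
Proof. by apply: measurable_funB => //; exact: measurable_partial_score. Qed.

Lemma measurable_likelihood V n : measurable_fun setT (likelihood V n).
Proof. by apply: measurableT_comp => //; exact: measurable_log_likelihood. Qed.

Lemma likelihood_ge0 V n w : 0 <= likelihood V n w.
Proof. exact: expR_ge0. Qed.

Lemma measurable_finite_shift V n : measurable_fun setT (finite_shift V n).
Proof.
apply: measurable_fun_coord_space => y.
by apply: measurable_funD => //; exact: measurable_coord.
Qed.

Lemma measurable_full_shift V : measurable_fun setT (full_shift V).
Proof.
apply: measurable_fun_coord_space => y.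
by apply: measurable_funD => //; exact: measurable_coord.
Qed.

(** The left side reads only coordinates of index below [m], where the two translations agree. *)
Lemma log_likelihood_shift V n m w : (m <= n)%N ->
  log_likelihood V m (finite_shift V n w) = log_likelihood V m (full_shift V w).
Proof.
move=> mn; rewrite /log_likelihood; congr (_ - _).
apply: eq_state_partial_sums => y ym.
by rewrite /finite_shift /full_shift (leq_trans ym mn) addrC.
Qed.

Variable P0 : probability Omega R.
Hypothesis P0_noise : noise_law sigma P0.

(** Induction on [n]. If [x n] is a state [j], the new likelihood is the old one times the tilt at
    [j], and the tilt amounts to translating coordinate [j], which the old likelihood does not read
    ([trL]). If [x n] is [None], nothing changes. *)
Lemma integral_likelihood V n (A : set Omega) : measurable A ->
  (\int[P0]_(w in A) (likelihood V n w)%:E = P0 (finite_shift V n @^-1` A))%E.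
Proof.
elim: n A => [A mA|n IHn A mA].
  have -> : finite_shift V 0 @^-1` A = A.
    by congr (_ @^-1` A); apply/funext => w; apply/funext => y; rewrite /finite_shift addr0.
  under eq_integral do rewrite /likelihood /log_likelihood /partial_score
    /partial_energy !state_partial_sums0 mulr0 subrr expR0.
  by rewrite integral_cst// mul1e.
case xn : (x n) => [j|]; last first.
  have -> : finite_shift V n.+1 = finite_shift V n.
    apply/funext => w; apply/funext => y; rewrite /finite_shift ltnS leq_eqVlt.
    by case: eqP => // yn; move: xn; rewrite -yn state_indexK.
  rewrite -IHn//; apply: eq_integral => w _.
  rewrite /likelihood /log_likelihood /partial_score /partial_energy.
  by rewrite !state_partial_sumsS xn/= !addr0.
have trL w : likelihood V n (translate j (V j) w) = likelihood V n w.
  rewrite /likelihood /log_likelihood; congr (expR (_ - _)).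
  apply: eq_state_partial_sums => y yn; rewrite /translate; case: eqVneq => [yj|_].
    by move: yn; rewrite yj (state_index_unique xn) ltnn.
  by rewrite addr0.
have -> : finite_shift V n.+1 @^-1` A = finite_shift V n @^-1` (translate j (V j) @^-1` A).
  rewrite -comp_preimage; congr (_ @^-1` A); apply/funext => w; apply/funext => y.
  rewrite /finite_shift /translate /= ltnS leq_eqVlt.
  have [->|yj] := eqVneq y j; first by rewrite (state_index_unique xn) eqxx ltnn addr0.
  case: eqP => [yn|_]; last by rewrite addr0.
  by move: xn yj; rewrite -yn state_indexK => -[->]; rewrite eqxx.
have mb : measurable (translate j (V j) @^-1` A).
  by rewrite -[X in measurable X]setTI; exact: measurable_translate.
rewrite -IHn//.
under [RHS]eq_integral do rewrite -trL.
have mL : measurable_fun setT (fun w => (likelihood V n w)%:E).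
  by apply/measurable_EFinP; exact: measurable_likelihood.
have L0 w : (0 <= (likelihood V n w)%:E)%E by rewrite lee_fin likelihood_ge0.
transitivity (\int[pushforward_measure P0 (measurable_translate j (V j))]_(w in A)
    (likelihood V n w)%:E)%E; last first.
  rewrite [LHS](ge0_integral_pushforward (measurable_translate j (V j)))//.
  exact: measurable_funTS.
rewrite [RHS](@ge0_integral_density _ _ _ P0 _ (measurable_tilt sigma j (V j))
  (tilt_ge0 sigma j (V j)))//; last first.
  by move=> B mB; rewrite (integral_tilt sigma_gt0 P0_noise).
apply: eq_integral => w _.
rewrite -EFinM /likelihood /tilt -expRD; congr (expR _)%:E.
rewrite /log_likelihood /partial_score /partial_energy !state_partial_sumsS xn/=.
by ring.
Qed.

(* Doob's inequality for the likelihood martingale, by optional stopping: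
   tilting by the likelihood at the first passage time at most [k] amounts to
   translating, and a translation past coordinate [k] does not affect whether
   that time equals [k]. *)
Lemma likelihood_maximal_inequality V (l : R) :
  (P0 (\bigcup_n [set w | (l <= log_likelihood V n w)%R]) <= (expR (- l))%:E)%E.
Proof.
pose B n := [set w : Omega | l <= log_likelihood V n w].
have mB n : measurable (B n).
  by apply: measurable_superlevel; exact: measurable_log_likelihood.
pose A := seqDU B.
have AE n w : A n w <-> B n w /\ forall m, (m < n)%N -> ~ B m w.
  rewrite /A /seqDU -bigcup_mkord; split.
    by move=> [Bn h]; split => // m mn Bm; apply: h; exists m.
  by move=> [Bn h]; split => // -[m mn]; exact: h.
have mA n : measurable (A n).
  by apply: measurableD => //; exact: bigsetU_measurable.
pose Q := pushforward_measure P0 (measurable_full_shift V).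
(* The likelihood is at least [expR l] on [A n]. The measure [Q] is the same for all [n], so summing
   over the disjoint [A n] leaves a total [Q]-mass of at most 1. *)
have AQ n : (P0 (A n) <= (expR (- l))%:E * Q (A n))%E.
  have -> : Q (A n) = P0 (finite_shift V n @^-1` A n).
    rewrite /Q /= /pushforward; congr (P0 _).
    apply/seteqP; split => w /AE[Bw h]; apply/AE; split.
    + by rewrite /B /= log_likelihood_shift.
    + by move=> m mn; rewrite /B /= log_likelihood_shift 1?ltnW//; exact: h.
    + by move: Bw; rewrite /B /= log_likelihood_shift.
    + by move=> m mn; have := h m mn; rewrite /B /= log_likelihood_shift 1?ltnW.
  rewrite -integral_likelihood// -ge0_integralZl_EFin ?expR_ge0//; last 2 first.
  - by move=> w _; rewrite lee_fin likelihood_ge0.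
  - by apply: measurable_funTS; apply/measurable_EFinP; exact: measurable_likelihood.
  rewrite -[leLHS]mul1e -integral_cst//; apply: ge0_le_integral => //.
  - apply: measurable_funTS; apply/measurable_EFinP; apply: measurable_funM => //.
    exact: measurable_likelihood.
  - move=> w /AE[Bw _]; rewrite -EFinM lee_fin /likelihood -expRD.
    by rewrite -[leLHS]expR0 ler_expR addrC subr_ge0.
have tA : trivIset setT A by exact: trivIset_seqDU.
have mUA : measurable (\bigcup_n A n) by exact: bigcup_measurable.
rewrite [X in P0 X](seqDU_bigcup_eq B) measure_semi_bigcup//.
apply: (le_trans (lee_nneseries _ (fun n _ => AQ n))) => //.
rewrite nneseriesZl// -measure_semi_bigcup//.
rewrite -[leRHS]mule1; apply: lee_pmul => //.
apply: probability_le1.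
rewrite -[X in measurable X]setTI; exact: measurable_full_shift.
Qed.

End Score.

(** * Almost sure convergence of the scores *)

Section NoiseScore.
Variables (R : realType) (X : choiceType) (x : nat -> option X) (sigma : X -> R).
Hypotheses (x_listing : listing x) (sigma_gt0 : forall y, 0 < sigma y).
Local Notation Omega := (coord_space X R).
Variable P0 : probability Omega R.
Hypothesis P0_noise : noise_law sigma P0.
Implicit Types (V : X -> R) (w : Omega) (n m : nat).
Local Notation partial_score := (partial_score x sigma).
Local Notation partial_energy := (partial_energy x sigma).
Local Notation likelihood := (likelihood x sigma).
Local Notation log_likelihood := (log_likelihood x sigma).
Local Notation full_shift := (@full_shift R X).

Lemma partial_energyZ V (a : R) n :
  partial_energy (fun y => a * V y) n = a ^+ 2 * partial_energy V n.
Proof.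
rewrite -state_partial_sumsZ; congr (state_partial_sums x _ n).
by apply/funext => y; rewrite exprMn mulrA.
Qed.

Lemma partial_scoreZ V (a : R) n w :
  partial_score (fun y => a * V y) n w = a * partial_score V n w.
Proof.
rewrite -state_partial_sumsZ; congr (state_partial_sums x _ n).
by apply/funext => y; rewrite !mulrA.
Qed.

(** Makes the increments after [m] partial sums of a tail portfolio, so that the maximal inequality,
    stated for whole sums, controls oscillations. *)
Lemma state_partial_sums_tail (F : X -> R) m k :
  state_partial_sums x
    (fun y => if (m <= state_index x_listing y)%N then F y else 0) (m + k)%N =
  state_partial_sums x F (m + k)%N - state_partial_sums x F m.
Proof.
elim: k => [|k IHk].
  (* Zero is written as a product so that [state_partial_sumsZ] evaluates its sums. *)
  rewrite addn0 subrr (@eq_state_partial_sums _ _ _ x_listing _ (fun=> 0 * 0)).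
    by rewrite state_partial_sumsZ mul0r.
  by move=> y ym; rewrite leqNgt ym mul0r.
rewrite addnS !state_partial_sumsS IHk addrAC; congr (_ + _).
case xm : (x (m + k)%N) => [y|]//=.
by rewrite (state_index_unique x_listing xm) leq_addr.
Qed.

Lemma partial_energy_nd V : nondecreasing_seq (partial_energy V).
Proof.
apply/nondecreasing_seqP => n; rewrite /partial_energy state_partial_sumsS lerDl.
by case: (x n) => //= y; rewrite divr_ge0 ?sqr_ge0.
Qed.

Lemma is_cvg_partial_energy V : square_summable x sigma V -> cvgn (partial_energy V).
Proof.
set u := fun n => (oapp (fun y => V y ^+ 2 / sigma y ^+ 2) 0 (x n)).
have u0 n : (0 <= (u n)%:E)%E.
  by rewrite lee_fin /u; case: (x n) => //= y; rewrite divr_ge0 ?sqr_ge0.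
move=> Vs; apply: nondecreasing_is_cvgn; first exact: partial_energy_nd.
exists (fine (\sum_(0 <= n <oo) (u n)%:E)%E) => _ [n _ <-].
rewrite -lee_fin fineK; last first.
  by rewrite ge0_fin_numE// nneseries_ge0.
rewrite /partial_energy /state_partial_sums /series/= -sumEFin.
exact: (@nneseries_lim_ge R (EFin \o u) xpredT 0 n (fun i _ _ => u0 i)).
Qed.

Lemma partial_energy_tail V (r : R) : square_summable x sigma V -> 0 < r ->
  exists m, forall k, partial_energy V (m + k)%N - partial_energy V m <= r.
Proof.
move=> /is_cvg_partial_energy/cvgn_oscillationP cV r0.
have [j] := ltr_add_invr r0; rewrite add0r => jr.
have [m hm] := cV j; exists m => k.
by rewrite (le_trans (ler_norm _))// ltW// (lt_trans (hm k)).
Qed.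

(** A Chernoff bound uniform in [k]: the maximal inequality for [t V] cut off below index [m]. Its
    log-likelihood is [t] times the score increment minus [t ^+ 2 / 2] times the energy increment,
    which is at most [r]. *)
Lemma score_increment_tail V m (r e t : R) : 0 < t ->
  (forall k, partial_energy V (m + k)%N - partial_energy V m <= r) ->
  (P0 (\bigcup_k [set w |
     (e <= partial_score V (m + k)%N w - partial_score V m w)%R]) <=
   (expR (- (t * e - 2^-1 * (t ^+ 2 * r))))%:E)%E.
Proof.
move=> t0 hr.
pose V' y := if (m <= state_index x_listing y)%N then t * V y else 0.
apply: (le_trans _ (likelihood_maximal_inequality x_listing sigma_gt0 P0_noise V'
  (t * e - 2^-1 * (t ^+ 2 * r)))).
apply: le_measure; rewrite ?inE.
- apply: bigcup_measurable => k _; apply: measurable_superlevel.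
  by apply: measurable_funB; exact: measurable_partial_score.
- apply: bigcup_measurable => k _; apply: measurable_superlevel.
  exact: measurable_log_likelihood.
move=> w [k _ /= ek]; exists (m + k)%N => //=.
rewrite /log_likelihood.
have -> : partial_score V' (m + k)%N w =
    t * (partial_score V (m + k)%N w - partial_score V m w).
  rewrite mulrBr -!partial_scoreZ -state_partial_sums_tail.
  congr (state_partial_sums x _ _); apply/funext => y; rewrite /V'.
  by case: ifP => // _; rewrite !mul0r.
have -> : partial_energy V' (m + k)%N =
    t ^+ 2 * (partial_energy V (m + k)%N - partial_energy V m).
  rewrite mulrBr -!partial_energyZ -state_partial_sums_tail.
  congr (state_partial_sums x _ _); apply/funext => y; rewrite /V'.
  by case: ifP => // _; rewrite expr0n/= !mul0r.
apply: lerB; first by rewrite ler_pM2l.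
by rewrite ler_pM2l// ler_wpM2l// sqr_ge0.
Qed.

Lemma partial_score_not_cvg V : square_summable x sigma V ->
  P0 [set w | ~ cvgn (partial_score V ^~ w)] = 0%E.
Proof.
move=> Vs; have mS := measurable_partial_score x sigma V.
rewrite (not_cvgn_oscillation (partial_score V)).
apply/negligibleP; first by apply: bigcup_measurable => j _;
  apply: bigcap_measurable => // m _; exact: measurable_oscillation_set.
apply: negligible_bigcup => j; set e := j.+1%:R^-1.
have e0 : 0 < e :> R by rewrite invr_gt0.
apply/negligibleP; first by
  apply: bigcap_measurable => // m _; exact: measurable_oscillation_set.
apply/eqP; rewrite eq_le measure_ge0 andbT; apply/lee_addgt0Pr => d d0.
rewrite add0e.
(* With [t * e = 1 + a] and tail energy at most [1 / t ^+ 2], the Chernoff exponent is [a + 1/2].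
   Since [expR (a + 1/2)] exceeds [a / 2 = 2 / d], each one-sided event has probability at most
   [d / 2]. *)
pose a := 4 / d; have a0 : 0 < a by rewrite divr_gt0.
pose t := (1 + a) / e.
have t0 : 0 < t by rewrite divr_gt0// addr_gt0.
have [m hm] := partial_energy_tail Vs (divr_gt0 ltr01 (exprn_gt0 2 t0)).
(* The values [b = 1] and [b = -1] give the two signs of the oscillation; both portfolios have the
   energy of [V]. *)
pose U (b : R) := \bigcup_k [set w : Omega | e <=
  partial_score (fun y => b * V y) (m + k)%N w - partial_score (fun y => b * V y) m w].
have mU b : measurable (U b).
  apply: bigcup_measurable => k _; apply: measurable_superlevel.
  by apply: measurable_funB; exact: measurable_partial_score.
have PU b : b ^+ 2 = 1 -> (P0 (U b) <= (d / 2)%:E)%E.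
  move=> b2; apply: (le_trans (@score_increment_tail _ m (1 / t ^+ 2) e t t0 _)).
    by move=> k; rewrite !partial_energyZ b2 !mul1r -[leRHS]mul1r; exact: hm.
  rewrite lee_fin mul1r divff ?gt_eqF ?exprn_gt0// /t divfK ?gt_eqF// expRN.
  rewrite -[leRHS]invrK lef_pV2 ?posrE ?expR_gt0 ?invr_gt0 ?divr_gt0//.
  apply: le_trans (expR_ge1Dx _).
  rewrite invf_div (_ : 2 / d = a / 2); last by rewrite /a; field; rewrite gt_eqF.
  by lra.
apply: (@le_trans _ _ (P0 (U 1 `|` U (-1)))).
  apply: le_measure; rewrite ?inE.
  - by apply: bigcap_measurable => // k _; exact: measurable_oscillation_set.
  - exact: measurableU.
  move=> w /(_ m Logic.I)[k _ /=]; rewrite ler_normr => /orP[h|h]; [left|right];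
    exists k => //=; rewrite !partial_scoreZ.
    by rewrite !mul1r.
  by rewrite !mulN1r -opprD.
apply: (le_trans (measureU2 _ _ _)) => //.
rewrite [in leRHS](splitr d) EFinD; apply: leeD; apply: PU.
  by rewrite expr1n.
by rewrite sqrrN expr1n.
Qed.

End NoiseScore.

(** * The Cameron-Martin formula for infinitely many states *)

Section LimitLikelihood.
Variables (R : realType) (X : choiceType) (x : nat -> option X) (sigma : X -> R).
Hypotheses (x_listing : listing x) (sigma_gt0 : forall y, 0 < sigma y).
Local Notation Omega := (coord_space X R).
Variable P0 : probability Omega R.
Hypothesis P0_noise : noise_law sigma P0.
Variable V : X -> R.
Hypothesis V_summable : square_summable x sigma V.
Local Notation partial_score := (partial_score x sigma).
Local Notation partial_energy := (partial_energy x sigma).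
Local Notation likelihood := (likelihood x sigma).
Local Notation full_shift := (@full_shift R X).

Definition score (w : Omega) : R :=
  state_sum x (fun y => V y * w y / sigma y ^+ 2).

Definition energy : R := state_sum x (fun y => V y ^+ 2 / sigma y ^+ 2).

Definition limit_likelihood (w : Omega) : R := expR (score w - 2^-1 * energy).

Lemma measurable_score : measurable_fun setT score.
Proof. exact: (measurable_limn (measurable_partial_score x sigma V)). Qed.

Lemma measurable_limit_likelihood : measurable_fun setT limit_likelihood.
Proof.
apply: measurableT_comp => //; apply: measurable_funB => //.
exact: measurable_score.
Qed.

Lemma limit_likelihood_ge0 w : 0 <= limit_likelihood w.
Proof. exact: expR_ge0. Qed.

Lemma cvg_likelihood w : cvgn (partial_score V ^~ w) ->
  likelihood V n w @[n --> \oo] --> limit_likelihood w.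
Proof.
move=> cw; apply: continuous_cvg; first exact: continuous_expR.
apply: cvgB => //; apply: cvgMr => //.
exact: (is_cvg_partial_energy V_summable).
Qed.

Lemma partial_energy_le n : partial_energy V n <= energy.
Proof.
apply: nondecreasing_cvgn_le; first exact: partial_energy_nd.
exact: is_cvg_partial_energy.
Qed.

(** A rectangle reads finitely many coordinates, all of which the finite translations have reached
    once [n] exceeds their largest index. *)
Lemma full_shift_rectangle (J : {fset X}) (B : X -> set R) :
  exists N, forall n, (N <= n)%N ->
    finite_shift x_listing V n @^-1` rectangle J B =
    full_shift V @^-1` rectangle J B.
Proof.
exists (\max_(y <- J) state_index x_listing y).+1 => n Nn.
have JE w y : y \in J -> finite_shift x_listing V n w y = full_shift V w y.
  move=> yJ; rewrite /finite_shift /full_shift addrC ifT//.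
  by apply: leq_trans Nn; rewrite ltnS; exact: leq_bigmax_seq.
by apply/seteqP; split => w h y yJ; have := h y yJ; rewrite /= JE.
Qed.

(** The exponents agree because [2 S - c = c + (2 S - 2 c)], and [2 V] has energy [4 c]. As the
    likelihood of [2 V] integrates to at most 1, the second moment is at most [expR energy]. *)
Lemma likelihood_sqr n w : likelihood V n w ^+ 2 =
  expR (partial_energy V n) * likelihood (fun y => 2 * V y) n w.
Proof.
rewrite -expRM_natl -expRD; congr expR.
rewrite /log_likelihood partial_scoreZ partial_energyZ.
by field.
Qed.

(* The likelihoods are bounded in L^2, hence uniformly integrable: no mass is
   lost in the limit. *)
Lemma integral_likelihood_truncation n (A : set Omega) (l : R) :
  0 < l -> measurable A ->
  (P0 (finite_shift x_listing V n @^-1` A) <=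
   \int[P0]_(w in A) (Num.min (likelihood V n w) l)%:E + (expR energy / l)%:E)%E.
Proof.
move=> l0 mA; rewrite -(integral_likelihood x_listing sigma_gt0 P0_noise)//.
have mL W : measurable_fun setT (likelihood W n) by exact: measurable_likelihood.
have mM : measurable_fun setT (fun w => Num.min (likelihood V n w) l).
  by apply: measurable_minr.
have M0 w : 0 <= Num.min (likelihood V n w) l by rewrite le_min likelihood_ge0 ltW.
have mS : measurable_fun setT (fun w => likelihood V n w ^+ 2) by exact: measurable_funX.
have sq : (\int[P0]_(w in A) (likelihood V n w ^+ 2)%:E <= (expR energy)%:E)%E.
  under eq_integral do rewrite likelihood_sqr EFinM.
  rewrite ge0_integralZl_EFin ?expR_ge0//; last 2 first.
  - by move=> w _; rewrite lee_fin likelihood_ge0.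
  - by apply: measurable_funTS; apply/measurable_EFinP.
  rewrite (integral_likelihood x_listing sigma_gt0 P0_noise)// -[leRHS]mule1.
  apply: lee_pmul => //.
    by rewrite lee_fin ler_expR partial_energy_le.
  apply: probability_le1; rewrite -[X in measurable X]setTI.
  exact: measurable_finite_shift.
(* Pointwise [v <= min(v, l) + v ^+ 2 / l]: beyond [l], the last term alone is at least [v]. *)
apply: (@le_trans _ _ (\int[P0]_(w in A)
   ((Num.min (likelihood V n w) l)%:E + (l^-1)%:E * (likelihood V n w ^+ 2)%:E))%E).
  apply: ge0_le_integral => //.
  - by move=> w _; rewrite lee_fin likelihood_ge0.
  - by apply: measurable_funTS; apply/measurable_EFinP.
  - apply: measurable_funTS; apply/measurable_EFinP.
    by apply: measurable_funD => //; exact: measurable_funM.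
  - move=> w _; rewrite -EFinM -EFinD lee_fin.
    have := likelihood_ge0 x sigma V n w; set v := likelihood V n w => v0.
    case: (leP v l) => [_|lv].
      by rewrite lerDl mulr_ge0 ?sqr_ge0// invr_ge0 ltW.
    rewrite -[leLHS]add0r; apply: lerD; first exact: ltW.
    rewrite expr2 mulrA ler_peMl// mulrC.
    by rewrite ler_pdivlMr// mul1r ltW.
rewrite ge0_integralD//; last 4 first.
- by move=> w _; rewrite lee_fin.
- by apply: measurable_funTS; apply/measurable_EFinP.
- by move=> w _; rewrite -EFinM lee_fin mulr_ge0 ?sqr_ge0// invr_ge0 ltW.
- apply: measurable_funTS; apply/measurable_EFinP; exact: measurable_funM.
have linv : 0 <= l^-1 by rewrite invr_ge0 ltW.
rewrite leeD2l// ge0_integralZl_EFin//; last 2 first.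
- by move=> w _; rewrite lee_fin sqr_ge0.
- by apply: measurable_funTS; apply/measurable_EFinP.
by rewrite [expR energy / l]mulrC EFinM lee_wpmul2l.
Qed.

(** On a rectangle the integrals of the finite likelihoods equal the right-hand side for all large
    [n], so only the exchange of limit and integral is at stake. *)
Lemma integral_limit_likelihood_rectangle (J : {fset X}) (B : X -> set R) :
  (forall y, measurable (B y)) ->
  (\int[P0]_(w in rectangle J B) (limit_likelihood w)%:E =
   P0 (full_shift V @^-1` rectangle J B))%E.
Proof.
move=> mB; set A := rectangle J B.
have mA : measurable A by exact: measurable_rectangle.
have mS := measurable_partial_score x sigma V.
pose D := [set w : Omega | ~ cvgn (partial_score V ^~ w)].
have mD : measurable D by apply: measurableC; exact: (measurable_cvgn mS).
have D0 : P0 D = 0%E by exact: (partial_score_not_cvg x_listing sigma_gt0 P0_noise).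
have mAD : measurable (A `\` D) by exact: measurableD.
have mL : measurable_fun setT (EFin \o limit_likelihood).
  by apply/measurable_EFinP; exact: measurable_limit_likelihood.
have ml n : measurable_fun setT (EFin \o likelihood V n).
  by apply/measurable_EFinP; exact: measurable_likelihood.
have [N hN] := full_shift_rectangle J B; rewrite -/A in hN.
apply/eqP; rewrite eq_le; apply/andP; split.
(* Upper bound by Fatou's lemma, off the null set [D] where the likelihoods may fail to converge. *)
- rewrite (ge0_negligible_integral mD)//; last 2 first.
  + exact: measurable_funTS.
  + by move=> w _; rewrite lee_fin limit_likelihood_ge0.
  rewrite [leLHS](_ : _ = \int[P0]_(w in A `\` D)
      limn_einf (fun n => (likelihood V n w)%:E))%E; last first.
    apply: eq_integral => w /set_mem[_ /contrapT cw].
    have lw : (likelihood V n w)%:E @[n --> \oo] --> (limit_likelihood w)%:E.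
      by apply/fine_cvgP; split; [exact: nearW|exact: cvg_likelihood].
    by rewrite (cvg_limn_einf_sup lw).1.
  apply: (le_trans (@fatou _ _ _ P0 _ mAD (fun n w => (likelihood V n w)%:E)
    (fun n => measurable_funTS (ml n)) (fun n w _ => likelihood_ge0 x sigma V n w))).
  have lA : (\int[P0]_(w in A `\` D) (likelihood V n w)%:E)%E @[n --> \oo] -->
      P0 (full_shift V @^-1` A).
    apply: cvg_near_cst; exists N => // n /= Nn.
    rewrite -ge0_negligible_integral//.
    + by rewrite (integral_likelihood x_listing sigma_gt0 P0_noise)// hN.
    + exact: (measurable_funTS (ml n)).
    + by move=> w _; rewrite lee_fin likelihood_ge0.
  by rewrite (cvg_limn_einf_sup lA).1.
(* Lower bound: the truncated likelihoods are dominated by the constant [l], chosen so that the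
   truncation loss [expR energy / l] is exactly [e]. *)
apply/lee_addgt0Pr => e e0.
have l0 : 0 < expR energy / e by rewrite divr_gt0 ?expR_gt0.
set l := expR energy / e in l0.
have mM n : measurable_fun setT (EFin \o (fun w => Num.min (likelihood V n w) l)).
  by apply/measurable_EFinP; apply: measurable_minr => //; exact: measurable_likelihood.
have mML : measurable_fun setT (EFin \o (fun w => Num.min (limit_likelihood w) l)).
  by apply/measurable_EFinP; apply: measurable_minr => //; exact: measurable_limit_likelihood.
have M0 n w : 0 <= Num.min (likelihood V n w) l.
  by rewrite le_min likelihood_ge0 ltW.
have [||_ _ ucvg] := @dominated_convergence _ _ _ P0 A mA
  (fun n w => (Num.min (likelihood V n w) l)%:E)
  (fun w => (Num.min (limit_likelihood w) l)%:E) (cst l%:E)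
  (fun n => measurable_funTS (mM n)) (measurable_funTS mML) _
  (finite_measure_integrable_cst P0 l mA) _.
- exists D; split => // w /= /not_implyP[Aw nc] cw; apply: nc.
  apply: cvg_EFin; first exact: nearW.
  (* Expressing the minimum by an absolute value reduces its limit to those of sums and norms. *)
  rewrite /comp /= minr_absE; under eq_fun do rewrite minr_absE.
  have lw := cvg_likelihood cw.
  apply: cvgMl; apply: cvgB; first by apply: cvgD => //; exact: cvg_cst.
  by apply: cvg_norm; apply: cvgB => //; exact: cvg_cst.
- by apply: aeW => w n _; rewrite gee0_abs ?lee_fin// ge_min lexx orbT.
apply: (@le_trans _ _ (\int[P0]_(w in A) (Num.min (limit_likelihood w) l)%:E + e%:E)%E); last first.
  rewrite leeD2r//; apply: ge0_le_integral => //.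
  + by move=> w _; rewrite lee_fin le_min limit_likelihood_ge0 ltW.
  + exact: (measurable_funTS mML).
  + exact: (measurable_funTS mL).
  + by move=> w _; rewrite lee_fin ge_min lexx.
rewrite -leeBlDr// -(cvg_lim _ ucvg)//; apply: lime_ge; first by apply/cvg_ex; eexists; exact: ucvg.
exists N => // n /= Nn; rewrite EFinN leeBlDr// -(hN n Nn).
have -> : e = expR energy / l by rewrite /l invf_div mulrCA divff ?mulr1// gt_eqF ?expR_gt0.
exact: integral_likelihood_truncation.
Qed.

Lemma integral_limit_likelihood (A : set Omega) : measurable A ->
  (\int[P0]_(w in A) (limit_likelihood w)%:E = P0 (full_shift V @^-1` A))%E.
Proof.
move=> mA.
pose m1 := density_measure P0 measurable_limit_likelihood limit_likelihood_ge0.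
pose m2 := pushforward_measure P0 (measurable_full_shift V).
have rect A' : @rectangles R X A' -> m1 A' = m2 A'.
  by move=> [J [B [mB ->]]]; exact: integral_limit_likelihood_rectangle.
apply: (@finite_measure_eq _ _ _ (@rectangles R X) m1 m2) => //.
- exact: measurable_rectangles.
- exact: setI_closed_rectangles.
- exact: rectanglesT.
- rewrite rect; last exact: rectanglesT.
  rewrite /m2/=; apply: (le_lt_trans (probability_le1 P0 _)); last by rewrite ltry.
  by rewrite -[X in measurable X]setTI; apply: measurable_full_shift.
Qed.

End LimitLikelihood.

(** * Posteriors *)

Section PosteriorTheory.
Context (R : realType) d (T : measurableType d) (P : probability T R).
Variables (S : finType) (s : T -> S).

(** On [E], under the law of [Y], both [p k] and [q k] are integrable (they lie between 0 and 1) and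
    have equal integrals over every measurable set. The exceptional null set in [E] pulls back along
    [Y]. *)
Lemma posterior_unique d' (E : measurableType d') (Y : T -> E)
    (p q : S -> E -> R) : measurable_fun setT Y ->
  is_posterior P s Y p -> is_posterior P s Y q ->
  {ae P, forall t, forall k, p k (Y t) = q k (Y t)}.
Proof.
move=> mY [mp p0 p1 pE] [mq q0 _ qE].
have mYA A : measurable A -> measurable (Y @^-1` A).
  by move=> mA; rewrite -[X in measurable X]setTI; exact: mY.
pose mu := pushforward_measure P mY.
have muE (r : E -> R) : measurable_fun setT r -> (forall e, 0 <= r e) ->
    forall A, measurable A ->
    (\int[mu]_(e in A) (r e)%:E = \int[P]_(t in Y @^-1` A) (r (Y t))%:E)%E.
  move=> mr r0 A mA; rewrite [LHS](ge0_integral_pushforward mY)//.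
  - by apply: measurable_funTS; exact/measurable_EFinP.
  - by move=> e _; rewrite lee_fin.
apply: filter_forall => k.
have : ae_eq mu setT (EFin \o p k) (EFin \o q k).
  apply: integral_ae_eq => //.
  - have mpk : measurable_fun setT (EFin \o p k) by exact/measurable_EFinP.
    apply/integrableP; split => //.
    under eq_integral do rewrite /= ger0_norm//.
    apply: (@le_lt_trans _ _ (\int[mu]_e (cst 1 e))%E).
      apply: ge0_le_integral => // [e _|e _]; first by rewrite lee_fin.
      by rewrite /= lee_fin -(p1 e) (bigD1 k)//= lerDl sumr_ge0.
    rewrite integral_cst// mul1e.
    by apply: (le_lt_trans (probability_le1 P _)); rewrite ?ltry//; exact: mYA.
  - exact/measurable_EFinP.
  - by move=> A _ mA; rewrite !muE// pE// qE.
move=> [N [mN N0 sN]]; exists (Y @^-1` N); split.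
- exact: mYA.
- exact: N0.
- move=> t /= nt; apply: sN => /= h; apply: nt.
  by have [] := h Logic.I.
Qed.

(** Events of [h \o Y] are among the events of [Y], so the defining identity for [p] already
    contains the one for [g]. *)
Lemma posterior_of_statistic d1 (E : measurableType d1) d2 (F : measurableType d2)
    (Y : T -> E) (h : E -> F) (p : S -> E -> R) (g : S -> F -> R) :
  measurable_fun setT h -> (forall k, measurable_fun setT (g k)) ->
  (forall k v, 0 <= g k v) -> (forall v, \sum_k g k v = 1) ->
  (forall k e, p k e = g k (h e)) ->
  is_posterior P s Y p -> is_posterior P s (h \o Y) g.
Proof.
move=> mh mg g0 g1 pg [_ _ _ pE]; split => // k A mA.
rewrite comp_preimage -pE; last first.
  by rewrite -[X in measurable X]setTI; exact: mh.
by apply: eq_integral => t _; rewrite pg.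
Qed.

End PosteriorTheory.

(** * Bayes' rule for the signal *)

Section BeliefPosterior.
Context (R : realType) (X : choiceType) (x : nat -> option X).
Variables (S : finType) (pi0 : S -> R) (sigma : X -> R).
Local Notation Omega := (coord_space X R).
Variables (P0 : probability Omega R) (W : X -> S -> R).
Context d (T : measurableType d) (P : probability T R).
Variables (omega : {RV P >-> Omega}) (s : T -> S).
Hypothesis x_listing : listing x.
Hypotheses (pi0_ge0 : forall k, 0 <= pi0 k) (pi0_sum1 : \sum_(k : S) pi0 k = 1).
Hypothesis sigma_gt0 : forall y, 0 < sigma y.
Hypothesis P0_noise : noise_law sigma P0.
Hypothesis W_summable : forall k, square_summable x sigma (W^~ k).
Hypothesis belief : market_maker_belief pi0 P0 W omega s.
Local Notation weight := (posterior_weight x pi0 sigma W).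
Local Notation normalizer := (normalizer x pi0 sigma W).
Local Notation scores := (scores x sigma W).
Local Notation posterior := (posterior_formula x pi0 sigma W).

(** [posterior_weight] with the score vector freed into a variable, so that the formula factors
    through the scores by computation, at every order flow. *)
Definition score_weight (k : S) (v : coord_space S R) : R :=
  expR (v k - 2^-1 * state_sum x (fun y => W y k ^+ 2 / sigma y ^+ 2)) * pi0 k.

Definition score_posterior (k : S) (v : coord_space S R) : R :=
  (\sum_(j : S) score_weight j v)^-1 * score_weight k v.

Lemma score_weight_ge0 k v : 0 <= score_weight k v.
Proof. by rewrite mulr_ge0 ?expR_ge0. Qed.

(** The exponentials are positive, so a zero sum would force every prior probability to vanish.
    Positivity holds at every vector, including those produced by default limits. *)
Lemma score_normalizer_gt0 v : 0 < \sum_(j : S) score_weight j v.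
Proof.
rewrite lt_neqAle sumr_ge0 ?andbT; last by move=> j _; exact: score_weight_ge0.
apply/eqP => /esym/eqP; rewrite psumr_eq0; last by move=> j _; exact: score_weight_ge0.
move=> /allP w0; have := pi0_sum1; rewrite big1 => [/esym/eqP|j _].
  by rewrite oner_eq0.
have := w0 j (mem_index_enum j); rewrite /= mulf_eq0 gt_eqF ?expR_gt0//.
by move/eqP.
Qed.

Lemma score_posterior_ge0 k v : 0 <= score_posterior k v.
Proof.
by rewrite mulr_ge0 ?score_weight_ge0// invr_ge0 ltW// score_normalizer_gt0.
Qed.

Lemma score_posterior_sum1 v : \sum_k score_posterior k v = 1.
Proof. by rewrite -mulr_sumr mulVf// gt_eqF// score_normalizer_gt0. Qed.

Lemma measurable_score_weight k : measurable_fun setT (score_weight k).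
Proof.
apply: measurable_funM => //; apply: measurableT_comp => //.
by apply: measurable_funB => //; exact: measurable_coord.
Qed.

Lemma measurable_score_posterior k : measurable_fun setT (score_posterior k).
Proof.
apply: measurable_funM; last exact: measurable_score_weight.
(* The inverse is turned into a real power, whose measurability is at hand. *)
have -> : (fun v => (\sum_(j : S) score_weight j v)^-1) =
    (fun v => (\sum_(j : S) score_weight j v) `^ (-1)).
  by apply/funext => v; rewrite powR_inv1// ltW// score_normalizer_gt0.
apply: (measurableT_comp (measurable_powR (-1))).
by apply: measurable_sum => j; exact: measurable_score_weight.
Qed.

Lemma measurable_scores : measurable_fun setT scores.
Proof.
apply: measurable_fun_coord_space => k.
exact: (measurable_score x sigma (W^~ k)).
Qed.

Lemma posteriorE k w : posterior k w = score_posterior k (scores w).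
Proof. by []. Qed.

Lemma measurable_weight k : measurable_fun setT (weight k).
Proof.
exact: (measurableT_comp (measurable_score_weight k) measurable_scores).
Qed.

Lemma measurable_normalizer : measurable_fun setT normalizer.
Proof. by apply: measurable_sum => j; exact: measurable_weight. Qed.

Lemma normalizer_gt0 w : 0 < normalizer w.
Proof. exact: score_normalizer_gt0. Qed.

Lemma measurable_preimage_omega A : measurable A -> measurable (omega @^-1` A).
Proof. by move=> mA; rewrite -[X in measurable X]setTI; exact: measurable_funP. Qed.

(** The weight is the prior times the Cameron-Martin density of the portfolio believed under signal
    [k]. *)
Lemma joint_law (k : S) (A : set Omega) : measurable A ->
  P (omega @^-1` A `&` s @^-1` [set k]) = (\int[P0]_(w in A) (weight k w)%:E)%E.
Proof.
move=> mA; rewrite belief.2//.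
rewrite -[portfolio_law _ _ _](integral_limit_likelihood x_listing sigma_gt0
  P0_noise (W_summable k) mA).
rewrite -ge0_integralZl_EFin//.
- by apply: eq_integral => w _; rewrite -EFinM mulrC.
- by move=> w _; rewrite lee_fin limit_likelihood_ge0.
- by apply: measurable_funTS; apply/measurable_EFinP; exact: measurable_limit_likelihood.
Qed.

(** Summation of [joint_law] over the signals, whose indicators add up to 1: the factor [C] of the
    formula is a likelihood in its own right. *)
Lemma order_flow_law (A : set Omega) : measurable A ->
  P (omega @^-1` A) = (\int[P0]_(w in A) (normalizer w)%:E)%E.
Proof.
move=> mA; have mB := measurable_preimage_omega mA.
have ms k : measurable (s @^-1` [set k]) := belief.1 k.
transitivity (\int[P]_(t in omega @^-1` A)
    (\sum_(k <- index_enum S) (\1_(s @^-1` [set k]) t)%:E))%E.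
  rewrite -[LHS]mul1e -integral_cst//; apply: eq_integral => t _.
  rewrite sumEFin (bigD1 (s t))//= big1 ?addr0.
    by rewrite indicE mem_set.
  by move=> k kst; rewrite indicE memNset//= => /esym/eqP; rewrite (negbTE kst).
rewrite ge0_integral_sum//; last first.
  by move=> k; apply: measurable_funTS; apply/measurable_EFinP; exact: measurable_indic.
under [RHS]eq_integral do rewrite -sumEFin.
rewrite ge0_integral_sum//.
- by apply: eq_bigr => k _; rewrite integral_indic// setIC; exact: joint_law.
- by move=> k; apply: measurable_funTS; apply/measurable_EFinP; exact: measurable_weight.
- by move=> k w _; rewrite lee_fin score_weight_ge0.
Qed.

(** Integrating against the law of order flow introduces the density [normalizer], which cancels the
    denominator and leaves the joint density [weight k]. *)
Lemma posterior_formula_is_posterior : is_posterior P s omega posterior.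
Proof.
have mp k : measurable_fun setT (posterior k).
  exact: (measurableT_comp (measurable_score_posterior k) measurable_scores).
split => //.
- by move=> k w; exact: score_posterior_ge0.
- by move=> w; exact: score_posterior_sum1.
move=> k A mA; rewrite joint_law//.
have mo : measurable_fun setT omega by exact: measurable_funP.
transitivity (\int[pushforward_measure P mo]_(w in A) (posterior k w)%:E)%E.
  apply/esym; rewrite [LHS](ge0_integral_pushforward mo)//.
  - by apply: measurable_funTS; exact/measurable_EFinP.
  - by move=> w _; rewrite lee_fin score_posterior_ge0.
rewrite (@ge0_integral_density _ _ _ P0 _ measurable_normalizer
  (fun w => ltW (normalizer_gt0 w)))//.
- apply: eq_integral => w _; rewrite -EFinM /posterior_formula mulrC mulrA.
  by rewrite divff ?mul1r// gt_eqF// normalizer_gt0.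
- by move=> B mB; exact: order_flow_law.
- exact/measurable_EFinP.
- by move=> w; rewrite lee_fin score_posterior_ge0.
Qed.

(** Divergence is null for the noise, hence for order flow, whose law has a density with respect to
    [P0]. *)
Lemma scores_converge_ae : {ae P, forall t, forall k,
  cvgn (state_partial_sums x (score_term sigma W (omega t) k))}.
Proof.
apply: filter_forall => k.
have mS := measurable_partial_score x sigma (W^~ k).
pose N := [set w : Omega | ~ cvgn (partial_score x sigma (W^~ k) ^~ w)].
have mN : measurable N by apply: measurableC; exact: (measurable_cvgn mS).
exists (omega @^-1` N); split => //; first exact: measurable_preimage_omega.
rewrite order_flow_law// null_set_integral//.
- by apply: measurable_funTS; apply/measurable_EFinP; exact: measurable_normalizer.
- exact: (partial_score_not_cvg x_listing sigma_gt0 P0_noise).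
Qed.

End BeliefPosterior.

(** A posterior is determined only up to null sets, so part (i) says that the formula is one version
    and that every version agrees with it almost surely. The convergence clause certifies that the
    sums in it are genuine limits almost surely. *)
Theorem theorem4p1 (R : realType) (X : choiceType) (x : nat -> option X)
    (S : finType) (pi0 : S -> R) (sigma : X -> R)
    (P0 : probability (coord_space X R) R) (W : X -> S -> R)
    (d : measure_display) (T : measurableType d) (P : probability T R)
    (omega : {RV P >-> coord_space X R}) (s : T -> S)
    (x_listing : listing x)
    (pi0_ge0 : forall k, 0 <= pi0 k) (pi0_sum1 : \sum_(k : S) pi0 k = 1)
    (sigma_gt0 : forall y, 0 < sigma y)
    (P0_noise : noise_law sigma P0)
    (W_summable : forall k, square_summable x sigma (W^~ k))
    (belief : market_maker_belief pi0 P0 W omega s) :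
  [/\ {ae P, forall t, forall k,
         cvgn (state_partial_sums x (score_term sigma W (omega t) k))},
      is_posterior P s omega (posterior_formula x pi0 sigma W) &
      forall pi : S -> coord_space X R -> R, is_posterior P s omega pi ->
        {ae P, forall t, forall k,
           pi k (omega t) = posterior_formula x pi0 sigma W k (omega t)}]
  /\
  (depends_only_through (posterior_formula x pi0 sigma W) (scores x sigma W) /\
   sufficient_statistic P s omega (scores x sigma W)).
Proof.
have post := posterior_formula_is_posterior x_listing pi0_ge0 pi0_sum1 sigma_gt0
  P0_noise W_summable belief.
have momega : measurable_fun setT omega by exact: measurable_funP.
split; first split => //.
- exact: (scores_converge_ae x_listing pi0_ge0 sigma_gt0 P0_noise W_summable belief).
- by move=> pi pi_post; exact: (posterior_unique momega pi_post post).
split.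
  exists (score_posterior x pi0 sigma W) => //.
  exact: measurable_score_posterior.
split; first exact: measurable_scores.
exists (score_posterior x pi0 sigma W).
  apply: (posterior_of_statistic (p := posterior_formula x pi0 sigma W)) => //.
  - exact: measurable_scores.
  - by move=> k; exact: measurable_score_posterior.
  - by move=> k v; exact: score_posterior_ge0.
  - by move=> v; exact: score_posterior_sum1.
by move=> pi pi_post; exact: (posterior_unique momega pi_post post).
Qed.
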